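(* Let $k,l\geq 1$ be integers. Then there exists a $(4kl^2+1,\,4k,\,l,\,1)$-$2$-CEDF in the cyclic group $\mathbb{Z}_{4kl^2+1}$.
   Context: For finite multisets/sets $A,B$ in an additive group, $\Delta(A,B)$ denotes the multiset $\{a-b : a\in A,\ b\in B\}$. Let $G$ be a group of order $n$, let $m>1$ and $1\le c\le m-1$. An ordered family $(A_0,\ldots,A_{m-1})$ of pairwise disjoint $l$-subsets of $G$ is an $(n,m,l,\lambda)$-$c$-CEDF (circular external difference family) if the multiset equation $\bigcup_{i=0}^{m-1}\Delta(A_{i+c \bmod m},A_i)=\lambda\,(G\setminus\{0\})$ holds, i.e. every nonzero element of $G$ occurs exactly $\lambda$ times in the multiset union and $0$ does not occur. *)

(* Defs.v *)
From HB Require Import structures.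
From mathcomp Require Import all_boot all_order all_algebra.

Set Implicit Arguments.
Unset Strict Implicit.
Unset Printing Implicit Defensive.

Import GRing.Theory.
Local Open Scope ring_scope.

(* Finite multisets over G are sequences up to [perm_eq], so that multiset     *)
(* union is concatenation and [flatten (nseq r s)] is r copies of s.          *)
Definition Delta (G : finZmodType) (A B : {set G}) : seq G :=
  [seq a - b | a <- enum A, b <- enum B].

Lemma shift_idx_subproof (m c : nat) (i : 'I_m) : ((i + c) %% m < m)%N.
Proof. by rewrite ltn_pmod // (leq_ltn_trans _ (ltn_ord i)). Qed.

Definition shift_idx (m c : nat) (i : 'I_m) : 'I_m :=
  Ordinal (shift_idx_subproof c i).

Record is_CEDF (G : finZmodType) (n m l lambda c : nat) (A : 'I_m -> {set G}) :
    Prop := IsCEDF {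
  CEDF_order : #|G| = n;
  CEDF_m_gt1 : (1 < m)%N;
  CEDF_c_range : (1 <= c <= m - 1)%N;
  CEDF_card : forall i : 'I_m, #|A i| = l;
  CEDF_disjoint : forall i j : 'I_m, i != j -> [disjoint A i & A j];
  CEDF_differences :
    perm_eq (flatten [seq Delta (A (shift_idx c i)) (A i) | i : 'I_m])
            (flatten (nseq lambda (enum ([set: G] :\ 0))))
}.

Arguments is_CEDF {G} n m l lambda c A.

(* Main.v *)
Require Import Defs.
From mathcomp Require Import all_boot all_order all_algebra.
From mathcomp Require Import zify.

(** Put N = 4k + 1. The case l = 1 asks for two disjoint 2k-cycles of integer
    labels in [0, 4k], small and large ends alternating, whose oriented steps
    represent each nonzero residue modulo N once. Replacing a small end x by
    { l^2 x + j : j < l } and a large end y by { l^2 y - l j : j < l } turns a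
    step d from x to y into the l^2 consecutive differences
    (d - 1) l^2 + 1, ..., d l^2, and the reversed step, modulo 4 k l^2 + 1, into
    the block belonging to N - d. This reduces the theorem to l = 1.

    For l = 1 the second cycle is the mirror image x |-> S - x of the first one.
    Mirroring exchanges small and large ends, so an edge of length d and its
    image account for both d and N - d, and it suffices to find a single
    2k-cycle avoiding its mirror image whose edge lengths are distinct even up
    to d ~ N - d. Such cycles are zigzags X 0, Y 0, X 1, Y 1, ... with a few
    displaced vertices, in five families according to k modulo 8; the small
    cases k = 1, 2, 5, 9 are separate. *)

Set Implicit Arguments.
Unset Strict Implicit.
Unset Printing Implicit Defensive.

Import GRing.Theory.

(** * Labellings: the case l = 1 *)

(* Indices congruent to 0 or 1 modulo 4 carry the small ends of the edges. *)
Definition low (i : nat) : bool := i %% 4 < 2.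

Definition succ2 (k i : nat) : nat := (i + 2) %% (4 * k).

(* The integer in [1, 4k] congruent to f (i + 2) - f i modulo 4k + 1. *)
Definition gap (k : nat) (f : nat -> nat) (i : nat) : nat :=
  if low i then f (succ2 k i) - f i else 4 * k + 1 - (f i - f (succ2 k i)).

(** [succ2] splits the indices into an even and an odd directed cycle of length 2k. Injectivity of
    the 4k gaps is enough, since they all lie in [1, 4k]. *)
Record labelling (k : nat) (f : nat -> nat) : Prop := Labelling {
  labelling_le : forall i, i < 4 * k -> f i <= 4 * k;
  labelling_inj : forall i j, i < 4 * k -> j < 4 * k -> f i = f j -> i = j;
  labelling_low : forall i, i < 4 * k -> low i -> f i < f (succ2 k i);
  labelling_high : forall i, i < 4 * k -> ~~ low i -> f (succ2 k i) < f i;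
  gap_inj : forall i j, i < 4 * k -> j < 4 * k -> gap k f i = gap k f j -> i = j
}.

Definition blow_up (l : nat) (f : nat -> nat) (i j : nat) : nat :=
  if low i then l ^ 2 * f i + j else l ^ 2 * f i - l * j.

Lemma low_succ2 k i : 0 < k -> low (succ2 k i) = ~~ low i.
Proof.
move=> k_gt0; rewrite /low /succ2.
have dvd4 : 4 %| 4 * k by rewrite dvdn_mulr.
rewrite modn_dvdm //; lia.
Qed.

Lemma succ2_lt k i : 0 < k -> succ2 k i < 4 * k.
Proof. by move=> k_gt0; rewrite ltn_mod muln_gt0. Qed.

(** * From a labelling to a CEDF *)

Section BlowUp.

Variables (k l : nat) (f : nat -> nat).
Hypotheses (k_gt0 : 0 < k) (l_gt0 : 0 < l) (f_lab : labelling k f).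

Local Notation N := (4 * k * l ^ 2 + 1).

Lemma low_label_lt i : i < 4 * k -> low i -> f i < 4 * k.
Proof.
move=> lt_i low_i; apply: leq_trans (labelling_low f_lab lt_i low_i) _.
exact/(labelling_le f_lab)/succ2_lt.
Qed.

Lemma high_label_gt0 i : i < 4 * k -> ~~ low i -> 0 < f i.
Proof. by move=> lt_i /(labelling_high f_lab lt_i); apply: leq_ltn_trans. Qed.

Lemma mul_lt_sqr j : j < l -> l * j + l <= l ^ 2.
Proof. by rewrite -mulnSr expnS expn1 leq_pmul2l. Qed.

Lemma sqr_mul_lt x y : x < y -> l ^ 2 * x + l ^ 2 <= l ^ 2 * y.
Proof. by move=> lt_xy; rewrite -mulnSr leq_mul2l lt_xy orbT. Qed.

Lemma blow_up_lt i j : i < 4 * k -> j < l -> blow_up l f i j < N.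
Proof.
move=> lt_i /mul_lt_sqr lt_j; rewrite /blow_up; case: ifP => low_i.
  by have := sqr_mul_lt (low_label_lt lt_i low_i); nia.
have := labelling_le f_lab lt_i; rewrite -(leq_pmul2l (m := l ^ 2)) ?expn_gt0 ?l_gt0 //.
by rewrite addn1 ltnS [4 * k * _]mulnC => ?; lia.
Qed.

(** A low set fills the l integers from l^2 x on; the nearest high set above it, with label x + 1,
    starts only at l^2 x + l. *)
Lemma blow_up_inj i j i' j' : i < 4 * k -> i' < 4 * k -> j < l -> j' < l ->
  blow_up l f i j = blow_up l f i' j' -> i = i' /\ j = j'.
Proof.
move=> lt_i lt_i' lt_j lt_j'; rewrite /blow_up.
have lj := mul_lt_sqr lt_j; have lj' := mul_lt_sqr lt_j'.
have f_inj : f i = f i' -> i = i' by exact: (labelling_inj f_lab).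
have gt0 m : m < 4 * k -> ~~ low m -> l ^ 2 <= l ^ 2 * f m.
  by move=> lt_m hi_m; rewrite leq_pmulr // high_label_gt0.
case: (boolP (low i)) => [low_i|hi_i]; case: (boolP (low i')) => [low_i'|hi_i'] eq_b.
- case: (ltngtP (f i) (f i')) => [/sqr_mul_lt||eq_f]; try by move/sqr_mul_lt; nia.
    by nia.
  by split; [exact: f_inj | move: eq_b; rewrite eq_f; lia].
- have {}gt0 := gt0 _ lt_i' hi_i'.
  case: (ltngtP (f i) (f i')) => [/sqr_mul_lt|/sqr_mul_lt|/f_inj eq_i]; try lia.
  by move: low_i; rewrite eq_i (negPf hi_i').
- have {}gt0 := gt0 _ lt_i hi_i.
  case: (ltngtP (f i) (f i')) => [/sqr_mul_lt|/sqr_mul_lt|/f_inj eq_i]; try lia.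
  by move: low_i'; rewrite -eq_i (negPf hi_i).
- have gti := gt0 _ lt_i hi_i; have gti' := gt0 _ lt_i' hi_i'.
  case: (ltngtP (f i) (f i')) => [/sqr_mul_lt|/sqr_mul_lt|eq_f]; try lia.
  split; first exact: f_inj.
  have /eqP : l * j = l * j' by move: eq_b; rewrite eq_f; rewrite eq_f in gti; lia.
  by rewrite eqn_pmul2l // => /eqP.
Qed.

Lemma gap_bounds i : i < 4 * k -> 0 < gap k f i <= 4 * k.
Proof.
move=> lt_i; have le1 := labelling_le f_lab lt_i.
have le2 := labelling_le f_lab (succ2_lt i k_gt0).
rewrite /gap; case: ifPn => [/(labelling_low f_lab lt_i)|]; first by lia.
by move/(labelling_high f_lab lt_i); lia.
Qed.

Lemma gap_onto d : 0 < d <= 4 * k -> exists2 i, i < 4 * k & gap k f i = d.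
Proof.
move=> d_range.
have F_lt (i : 'I_(4 * k)) : (gap k f i).-1 < 4 * k.
  by have := gap_bounds (ltn_ord i); lia.
pose F i := Ordinal (F_lt i).
have F_inj : injective F.
  move=> i j /(congr1 val) /= eq_g.
  apply/val_inj/(gap_inj f_lab (ltn_ord i) (ltn_ord j)).
  by have := gap_bounds (ltn_ord i); have := gap_bounds (ltn_ord j); lia.
have d_lt : d.-1 < 4 * k by lia.
have /codomP[i /(congr1 val) /= eq_d] := inj_card_onto F_inj (leqnn _) (Ordinal d_lt).
by exists i => //; have := gap_bounds (ltn_ord i); lia.
Qed.

Lemma N_gt1 : 1 < N.
Proof. by rewrite addn1 ltnS !muln_gt0 k_gt0 l_gt0. Qed.

Lemma card_Zp_N : #|'Z_N| = N.
Proof. by rewrite card_ord Zp_cast ?N_gt1. Qed.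

Local Notation A := (fun i : 'I_(4 * k) =>
  [set ((blow_up l f i j)%:R%R : 'Z_N) | j : 'I_l]).

Lemma Zp_nat_inj a b : a < N -> b < N -> (a%:R = b%:R :> 'Z_N)%R -> a = b.
Proof.
by move=> lt_a lt_b /(congr1 val); rewrite /= !val_Zp_nat ?N_gt1 // !modn_small.
Qed.

Lemma card_blow_up i : #|A i| = l.
Proof.
rewrite card_imset ?card_ord // => j j' /Zp_nat_inj eq_b; apply/val_inj.
by have [] := blow_up_inj (ltn_ord i) (ltn_ord i) (ltn_ord j) (ltn_ord j')
  (eq_b (blow_up_lt (ltn_ord _) (ltn_ord _)) (blow_up_lt (ltn_ord _) (ltn_ord _))).
Qed.

Lemma disjoint_blow_up (i i' : 'I_(4 * k)) : i != i' -> [disjoint A i & A i'].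
Proof.
move=> ne_i; apply/pred0Pn => -[x /andP[/imsetP[j _ ->] /imsetP[j' _ /Zp_nat_inj eq_b]]].
have [|/val_inj eq_i] := blow_up_inj (ltn_ord i) (ltn_ord i') (ltn_ord j) (ltn_ord j').
  by apply: eq_b; apply: blow_up_lt; apply: ltn_ord.
by rewrite eq_i eqxx in ne_i.
Qed.

(* With q and r the quotient and remainder of d - 1 by l^2, the difference d
   arises from the pair of sets whose gap is q + 1. *)
Lemma blow_up_gap d : 0 < d < N ->
  exists i j j', [/\ i < 4 * k, j < l, j' < l &
    ((blow_up l f (succ2 k i) j)%:R - (blow_up l f i j')%:R = d%:R :> 'Z_N)%R].
Proof.
move=> d_range.
have l2_gt0 : 0 < l ^ 2 by rewrite expn_gt0 l_gt0.
pose q := d.-1 %/ l ^ 2; pose r := d.-1 %% l ^ 2.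
have def_d : d = q * l ^ 2 + r + 1 by have := divn_eq d.-1 (l ^ 2); lia.
have lt_r : r < l ^ 2 by rewrite ltn_mod.
have lt_q : q < 4 * k by rewrite ltn_divLR //; lia.
have [|i lt_i gap_i] := @gap_onto q.+1; first by lia.
have split_l x : x < l ^ 2 -> [/\ x %/ l < l, x %% l < l & x = l * (x %/ l) + x %% l].
  move=> lt_x; rewrite ltn_divLR // ltn_mod l_gt0 -[l * l]/(l ^ 2) lt_x.
  by split=> //; rewrite {1}(divn_eq x l) mulnC.
have low_s := low_succ2 i k_gt0; have lt_s := succ2_lt i k_gt0.
(* [e] counts the wraps around N: 0 for a rising step, 1 for a falling one. *)
have eq_nat a b c e : a + e * N = b + c -> (a%:R - b%:R = c%:R :> 'Z_N)%R.
  have N0 : (N%:R = 0 :> 'Z_N)%R.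
    by apply/val_inj; rewrite /= val_Zp_nat ?N_gt1 // modnn.
  move=> /(congr1 (fun n => n%:R : 'Z_N)%R); rewrite !natrD natrM N0 mulr0 addr0 => ->.
  by rewrite addrC addKr.
move: gap_i; rewrite /gap; case: ifPn => [low_i|hi_i] gap_i.
(* The difference is (q + 1) l^2 - (l j + j'), so j and j' are the base-l digits of l^2 - r - 1. *)
- have [lt1 lt2 def_r] := split_l (l ^ 2 - r.+1) ltac:(lia).
  exists i, ((l ^ 2 - r.+1) %/ l), ((l ^ 2 - r.+1) %% l); split=> //.
  apply: (eq_nat _ _ _ 0); rewrite /blow_up low_s low_i /=.
  have := labelling_low f_lab lt_i low_i => lt_f.
  have -> : f (succ2 k i) = f i + q.+1 by lia.
  by rewrite mulnDr mulnS; lia.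
(* Modulo N the difference is q l^2 + l j' + j + 1, so the digits of r serve, in the other order. *)
- have [lt1 lt2 def_r] := split_l r lt_r.
  exists i, (r %% l), (r %/ l); split=> //.
  apply: (eq_nat _ _ _ 1); rewrite /blow_up low_s (negPf hi_i) /=.
  have lt_f := labelling_high f_lab lt_i hi_i.
  have le_f := labelling_le f_lab lt_i.
  have /mul_lt_sqr lj := lt1.
  have le_l2 : l ^ 2 <= l ^ 2 * f i by rewrite leq_pmulr // high_label_gt0.
  have eq_f : f (succ2 k i) + 4 * k = f i + q by lia.
  have : l ^ 2 * (f (succ2 k i) + 4 * k) = l ^ 2 * (f i + q) by rewrite eq_f.
  by rewrite !mulnDr [4 * k * _]mulnC [q * _]mulnC in def_d * => ?; lia.
Qed.

(** There are 4 k l^2 = N - 1 differences, so once every nonzero element occurs, each occurs exactly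
    once and 0 never. *)
Lemma CEDF_of_labelling : exists A : 'I_(4 * k) -> {set 'Z_N}, is_CEDF N (4 * k) l 1 2 A.
Proof.
exists A; split.
- exact: card_Zp_N.
- by lia.
- by lia.
- exact: card_blow_up.
- exact: disjoint_blow_up.
set D := flatten _; rewrite /= cats0.
set E := enum _.
have sizeE : size E = 4 * k * l ^ 2.
  have := cardsD1 (0%R : 'Z_N) setT.
  by rewrite in_setT cardsT card_Zp_N [in RHS]cardE -/E; move: (size E) => n; lia.
have sizeD : size D = 4 * k * l ^ 2.
  rewrite size_flatten /shape -map_comp.
  rewrite (eq_map (g := fun=> l ^ 2)); last first.
    move=> i; rewrite [LHS]/= size_allpairs -!cardE card_blow_up.
    by rewrite (card_blow_up (shift_idx 2 i)) mulnn.
  by rewrite sumnE big_map big_enum /= sum_nat_const card_ord.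
have sub : {subset E <= D}.
  move=> z; rewrite mem_enum !inE andbT => z_neq0.
  have z_range : 0 < z < N.
    have -> : z < N by apply: leq_trans (ltn_ord z) _; rewrite Zp_cast ?N_gt1.
    rewrite lt0n andbT.
    by apply: contra z_neq0 => /eqP z0; apply/eqP/val_inj.
  have [i [j [j' [lt_i lt_j lt_j' eq_z]]]] := blow_up_gap z_range.
  apply/flatten_mapP; exists (Ordinal lt_i); first by rewrite mem_enum.
  rewrite natr_Zp in eq_z; rewrite -eq_z.
  apply: allpairs_f; rewrite mem_enum.
    by apply/imsetP; exists (Ordinal lt_j).
  by apply/imsetP; exists (Ordinal lt_j').
have [_ eq_ED] := uniq_min_size (enum_uniq _) sub (eq_leq (etrans sizeD (esym sizeE))).
rewrite perm_sym; apply: uniq_perm => //; first exact: enum_uniq.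
by apply: leq_size_uniq (enum_uniq _) sub _; rewrite sizeD sizeE.
Qed.

End BlowUp.

(** * A half cycle and its mirror image *)

Definition cnext (m p : nat) : nat := if p.+1 < m then p.+1 else 0.

(** As subtraction truncates, positivity of this length forces small ends at even positions and
    large ends at odd ones. *)
Definition edge_length (m : nat) (h : nat -> nat) (p : nat) : nat :=
  if odd p then h p - h (cnext m p) else h (cnext m p) - h p.

Record half_cycle (k S : nat) (h : nat -> nat) : Prop := HalfCycle {
  half_sum_le : S <= 4 * k;
  half_le : forall p, p < 2 * k -> h p <= S;
  half_inj : forall p q, p < 2 * k -> q < 2 * k -> h p = h q -> p = q;
  half_mirror : forall p q, p < 2 * k -> q < 2 * k -> h p + h q != S;
  half_edge : forall p, p < 2 * k -> 0 < edge_length (2 * k) h p;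
  half_length_inj : forall p q, p < 2 * k -> q < 2 * k ->
    edge_length (2 * k) h p = edge_length (2 * k) h q -> p = q;
  half_length_mirror : forall p q, p < 2 * k -> q < 2 * k ->
    edge_length (2 * k) h p + edge_length (2 * k) h q != 4 * k + 1
}.

(* The even indices run through the cycle and the odd ones through its mirror
   image, started one step later so that small ends stay at low indices. *)
Definition mirrored (k S : nat) (h : nat -> nat) (i : nat) : nat :=
  if odd i then S - h (cnext (2 * k) i./2) else h i./2.

Lemma low_half i : low i = ~~ odd i./2.
Proof. by rewrite /low; lia. Qed.

Lemma cnext_lt m p : 0 < m -> cnext m p < m.
Proof. by rewrite /cnext; case: ifP. Qed.

Lemma cnext_inj m p q : p < m -> q < m -> cnext m p = cnext m q -> p = q.
Proof. by rewrite /cnext; case: ifP; case: ifP => ? ?; lia. Qed.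

Lemma odd_cnext k p : p < 2 * k -> odd (cnext (2 * k) p) = ~~ odd p.
Proof. by rewrite /cnext; case: ifP => ? ?; lia. Qed.

Lemma odd_succ2 k i : i < 4 * k -> odd (succ2 k i) = odd i.
Proof.
move=> lt_i; rewrite /succ2; case: (ltnP (i + 2) (4 * k)) => [lt_i2|ge_i2].
  by rewrite modn_small //; lia.
by rewrite -(subnK ge_i2) modnDr modn_small; lia.
Qed.

Lemma half_succ2 k i : i < 4 * k -> (succ2 k i)./2 = cnext (2 * k) i./2.
Proof.
move=> lt_i; rewrite /succ2 /cnext; case: (ltnP (i + 2) (4 * k)) => [lt_i2|ge_i2].
  by rewrite modn_small // ifT; lia.
by rewrite -(subnK ge_i2) modnDr modn_small ?ifF; lia.
Qed.

Section Mirror.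

Variables (k S : nat) (h : nat -> nat).
Hypotheses (k_gt0 : 0 < k) (h_half : half_cycle k S h).

Local Notation next := (cnext (2 * k)).
Local Notation len := (edge_length (2 * k) h).
Local Notation f := (mirrored k S h).

Lemma next_lt p : next p < 2 * k.
Proof. by apply: cnext_lt; rewrite muln_gt0. Qed.

Lemma half_lt i : i < 4 * k -> i./2 < 2 * k.
Proof. lia. Qed.

Lemma len_le p : p < 2 * k -> len p <= 4 * k.
Proof.
move=> lt_p; have := half_sum_le h_half.
have := half_le h_half lt_p; have := half_le h_half (next_lt p).
by rewrite /edge_length; case: ifP; lia.
Qed.

Lemma edge_ends p : p < 2 * k ->
  if odd p then h p = h (next p) + len p else h (next p) = h p + len p.
Proof.
by move=> lt_p; have := half_edge h_half lt_p; rewrite /edge_length; case: ifP; lia.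
Qed.

(** For odd i the step is the image of the edge leaving [next i./2], because the image starts one
    position later. *)
Lemma mirrored_step i : i < 4 * k ->
  let q := if odd i then next i./2 else i./2 in
  if low i then f (succ2 k i) = f i + len q else f i = f (succ2 k i) + len q.
Proof.
move=> lt_i /=; have lt_p := half_lt lt_i.
rewrite /mirrored odd_succ2 // half_succ2 // low_half.
case: (odd i); last by have := edge_ends lt_p; case: (odd i./2).
have := edge_ends (next_lt i./2); rewrite odd_cnext //.
have := half_le h_half (next_lt i./2).
have := half_le h_half (next_lt (next i./2)).
by case: (odd i./2) => /=; lia.
Qed.

Lemma labelling_mirrored : labelling k f.
Proof.
have le_S := half_sum_le h_half.
have le_p := half_le h_half.
pose q i := if odd i then next i./2 else i./2.
have lt_q i : i < 4 * k -> q i < 2 * k.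
  by rewrite /q; case: ifP => _ ?; [exact: next_lt | exact: half_lt].
have len_gt0 i : i < 4 * k -> 0 < len (q i) by move/lt_q/(half_edge h_half).
have q_inj i j : odd i = odd j -> i < 4 * k -> j < 4 * k -> q i = q j -> i = j.
  move=> odd_ij lt_i lt_j; rewrite /q odd_ij => eq_q.
  suff: i./2 = j./2 by lia.
  move: eq_q; case: ifP => // _; apply: cnext_inj; exact: half_lt.
split.
- move=> i lt_i; rewrite /mirrored; case: ifP => _; last first.
    exact: leq_trans (le_p _ (half_lt lt_i)) le_S.
  exact: leq_trans (leq_subr _ _) le_S.
- move=> i j lt_i lt_j eq_f.
  have [li lj] := (lt_q i lt_i, lt_q j lt_j).
  have := half_mirror h_half li lj; have := half_inj h_half li lj.
  have := le_p _ li; have := le_p _ lj; have := q_inj i j.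
  move: eq_f; rewrite /mirrored /q.
  by case: (odd i); case: (odd j) => *; lia.
- move=> i lt_i low_i; have := mirrored_step lt_i; rewrite low_i /= => ->.
  by rewrite -[X in X < _]addn0 ltn_add2l len_gt0.
- move=> i lt_i /negPf hi_i; have := mirrored_step lt_i; rewrite hi_i /= => ->.
  by rewrite -[X in X < _]addn0 ltn_add2l len_gt0.
(* Mirroring reverses rise and fall, so of d and 4k + 1 - d the cycle realises one and its image the
   other. *)
have gapE i : i < 4 * k ->
  gap k f i = if odd (q i) == odd i then len (q i) else 4 * k + 1 - len (q i).
  move=> lt_i; have := mirrored_step lt_i; rewrite /gap low_half -/(q i).
  have -> : odd (q i) = odd i (+) odd i./2.
    by rewrite /q; case: (odd i); rewrite ?odd_cnext ?half_lt.
  by case: (odd i); case: (odd i./2) => /= ->; lia.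
move=> i j lt_i lt_j; rewrite !gapE //.
have [li lj] := (lt_q i lt_i, lt_q j lt_j).
have /eqP ne_len := half_length_mirror h_half li lj.
have len_inj := half_length_inj h_half li lj.
have [le_i le_j] := (len_le li, len_le lj); have q_ij := q_inj i j.
by case: eqP => odd_i; case: eqP => odd_j eq_g; lia.
Qed.

End Mirror.

(** * Criteria for half cycles *)

Definition half_cycleb (k S : nat) (s : seq nat) : bool :=
  let h := nth 0 s in let len := edge_length (2 * k) h in
  (S <= 4 * k) && all (fun p => [&& h p <= S, 0 < len p & all (fun q =>
    [&& (h p == h q) ==> (p == q), h p + h q != S, (len p == len q) ==> (p == q)
      & len p + len q != 4 * k + 1]) (iota 0 (2 * k))]) (iota 0 (2 * k)).

Lemma half_cycleP k S s : half_cycleb k S s -> half_cycle k S (nth 0 s).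
Proof.
case/andP=> le_S /allP all_p.
have in_iota p : p < 2 * k -> p \in iota 0 (2 * k) by rewrite mem_iota.
split=> // [p /in_iota/all_p/and3P[]//|p q|p q|p /in_iota/all_p/and3P[]//|p q|p q];
  move=> /in_iota/all_p/and3P[_ _ /allP all_q] /in_iota/all_q/and4P[h1 h2 h3 h4] //.
- by move=> eq_h; apply/eqP; rewrite eq_h eqxx in h1.
- by move=> eq_l; apply/eqP; rewrite eq_l eqxx in h3.
Qed.

(* X' is the cyclic shift of X, so Y j has the neighbours X j and X' j; the
   conditions on lengths are stated without truncated subtraction. *)
Lemma half_cycle_of_ends k S (X X' Y : nat -> nat) :
  S <= 4 * k ->
  (forall j, j.+1 < k -> X' j = X j.+1) ->
  X' k.-1 = X 0 ->
  (forall j, j < k -> [/\ X j < k, k <= Y j & Y j + k <= S]) ->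
  (forall i j, i < k -> j < k -> X i = X j -> i = j) ->
  (forall i j, i < k -> j < k -> Y i = Y j -> i = j) ->
  (forall i j, i < k -> j < k -> Y i + Y j <> S) ->
  (forall i j, i < k -> j < k -> Y i + X j = Y j + X i -> i = j) ->
  (forall i j, i < k -> j < k -> Y i + X' j = Y j + X' i -> i = j) ->
  (forall i j, i < k -> j < k -> Y i + X' j <> Y j + X i) ->
  (forall i j, i < k -> j < k -> Y i + Y j <> 4 * k + 1 + X i + X j) ->
  (forall i j, i < k -> j < k -> Y i + Y j <> 4 * k + 1 + X' i + X' j) ->
  (forall i j, i < k -> j < k -> Y i + Y j <> 4 * k + 1 + X i + X' j) ->
  half_cycle k S (fun p => if odd p then Y p./2 else X p./2).
Proof.
move=> le_S X'S X'0 bnd injX injY mirY dXX dX'X' dX'X sXX sX'X' sXX'.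
set h := fun p => _.
have defX' j : j < k -> X' j = X (cnext k j).
  rewrite /cnext; case: ifP => [/X'S -> //|le_kj lt_j].
  by rewrite -X'0; congr (X' _); lia.
have lt_half p : p < 2 * k -> p./2 < k by lia.
have bX' j : j < k -> X' j < k.
  move=> lt_j; rewrite defX' //; have [] // := bnd (cnext k j).
  by apply: cnext_lt; lia.
have lenE p : p < 2 * k ->
  edge_length (2 * k) h p = if odd p then Y p./2 - X' p./2 else Y p./2 - X p./2.
  move=> lt_p; rewrite /edge_length /h odd_cnext //; case odd_p: (odd p) => /=.
    rewrite defX' ?lt_half //; congr (_ - X _); rewrite /cnext.
    by case: ifP; case: ifP; lia.
  by congr (Y _ - _); rewrite /cnext; case: ifP; lia.
split=> // [p /lt_half lt_p|p q|p q|p lt_p|p q|p q].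
- by have [] := bnd _ lt_p; rewrite /h; case: ifP; lia.
- move=> /[dup] /lt_half lt_p ? /[dup] /lt_half lt_q ?.
  have := injX _ _ lt_p lt_q; have := injY _ _ lt_p lt_q.
  have [] := bnd _ lt_p; have [] := bnd _ lt_q.
  by rewrite /h; case: ifP; case: ifP; lia.
(* Only two large ends can sum to S: the bounds give X + Y < S and X + X < 2k <= S. *)
- move=> /lt_half lt_p /lt_half lt_q.
  have := mirY _ _ lt_p lt_q; have [] := bnd _ lt_p; have [] := bnd _ lt_q.
  by rewrite /h; case: ifP; case: ifP; lia.
- have := lt_half _ lt_p => lt_j; rewrite lenE //.
  by have [] := bnd _ lt_j; have := bX' _ lt_j; case: ifP; lia.
- move=> lt_p lt_q; have [lt_i lt_j] := (lt_half _ lt_p, lt_half _ lt_q).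
  have [? ? ?] := bnd _ lt_i; have [? ? ?] := bnd _ lt_j.
  have := bX' _ lt_i; have := bX' _ lt_j.
  have := dXX _ _ lt_i lt_j; have := dX'X' _ _ lt_i lt_j.
  have := dX'X _ _ lt_i lt_j; have := dX'X _ _ lt_j lt_i.
  by rewrite !lenE //; case: ifP; case: ifP; lia.
- move=> lt_p lt_q; have [lt_i lt_j] := (lt_half _ lt_p, lt_half _ lt_q).
  have [? ? ?] := bnd _ lt_i; have [? ? ?] := bnd _ lt_j.
  have := bX' _ lt_i; have := bX' _ lt_j.
  have := sXX _ _ lt_i lt_j; have := sX'X' _ _ lt_i lt_j.
  have := sXX' _ _ lt_i lt_j; have := sXX' _ _ lt_j lt_i.
  by rewrite !lenE //; case: ifP; case: ifP; lia.
Qed.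

(** * Explicit half cycles *)

Lemma half_cycle2 : half_cycle 2 7 (nth 0 [:: 0; 4; 1; 2]).
Proof. exact: half_cycleP. Qed.

Lemma half_cycle5 : half_cycle 5 19 (nth 0 [:: 0; 9; 1; 7; 2; 6; 3; 5; 4; 11]).
Proof. exact: half_cycleP. Qed.

Lemma half_cycle9 : half_cycle 9 35
  (nth 0 [:: 0; 6; 1; 5; 2; 4; 3; 23; 7; 22; 8; 21; 9; 20; 10; 19; 11; 18]).
Proof. exact: half_cycleP. Qed.
(* The explicit families below were guessed from computer searches for small
   k; all their conditions are linear on each branch of the definitions. *)
Ltac half_cycle_cases :=
  intros;
  repeat match goal with H : context [if _ then _ else _] |- _ => revert H end;
  repeat (case: ifP => ?); first [lia | split; lia].

(** The lengths are 1, ..., 8t. Shifting Y from j = 2t on frees length 4t for the closing edge.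
    Since 8t would be its own mirror image, Y 0 takes the lengths 6t, 6t - 1 and Y t takes 8t, 8t -
    1. *)
Lemma half_cycle_4t t : 0 < t -> exists S h, half_cycle (4 * t) S h.
Proof.
move=> t_bound.
pose X (j : nat) := j.
pose X' (j : nat) := if j.+1 < 4 * t then j.+1 else 0.
pose Y (j : nat) :=
  if j == 0 then 6 * t else if j == t then 9 * t
  else if j < 2 * t then 8 * t - j else 8 * t - j.+1.
exists (16 * t), (fun p => if odd p then Y p./2 else X p./2).
by apply: (@half_cycle_of_ends _ _ X X' Y); rewrite /X /X' /Y; half_cycle_cases.
Qed.

(** The last Y supplies the skipped length 4t + 5, and its closing edge 8t + 7 stands for 8t + 6. *)
Lemma half_cycle_4t3 t : exists S h, half_cycle (4 * t + 3) S h.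
Proof.
pose X (j : nat) := j.
pose X' (j : nat) := if j < 4 * t + 2 then j.+1 else 0.
pose Y (j : nat) :=
  if j == 4 * t + 2 then 8 * t + 7 else if j.+1 == t then 9 * t + 8
  else if j.+1 < 2 * t then 8 * t + 3 - j
  else if j.+1 == 2 * t then 8 * t + 4 else 8 * t + 4 - j.
exists (16 * t + 12), (fun p => if odd p then Y p./2 else X p./2).
by apply: (@half_cycle_of_ends _ _ X X' Y); rewrite /X /X' /Y; half_cycle_cases.
Qed.

(** Y (2t) takes over the lengths 6t + 3 and 6t + 2 given up by Y (t - 1). *)
Lemma half_cycle_4t2 t : 0 < t -> exists S h, half_cycle (4 * t + 2) S h.
Proof.
move=> t_bound.
pose X (j : nat) := j.
pose X' (j : nat) := if j < 4 * t + 1 then j.+1 else 0.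
pose Y (j : nat) :=
  if j.+1 == t then 9 * t + 5 else if j < 2 * t then 8 * t + 1 - j
  else if j == 2 * t then 8 * t + 3
  else if j == 4 * t + 1 then 8 * t + 2 else 8 * t + 2 - j.
exists (16 * t + 7), (fun p => if odd p then Y p./2 else X p./2).
by apply: (@half_cycle_of_ends _ _ X X' Y); rewrite /X /X' /Y; half_cycle_cases.
Qed.

(** Small ends move too: the block 0, ..., 2t of X is rotated. The displaced index t - 2 requires t
    > 1. *)
Lemma half_cycle_8t1 t : 1 < t -> exists S h, half_cycle (8 * t + 1) S h.
Proof.
move=> t_bound.
pose X (j : nat) := if j < 2 * t then j.+1 else if j == 2 * t then 0 else j.
pose X' (j : nat) :=
  if j.+1 < 2 * t then j.+2 else if j.+1 == 2 * t then 0
  else if j == 8 * t then 1 else j.+1.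
pose Y (j : nat) :=
  if j.+2 == t then 15 * t + 1 else if j.+1 == t then 17 * t + 1
  else if j.+1 == 2 * t then 18 * t + 2
  else if j < 4 * t then 16 * t - j
  else if j == 4 * t then 16 * t + 1 else 16 * t + 1 - j.
exists (32 * t + 3), (fun p => if odd p then Y p./2 else X p./2).
by apply: (@half_cycle_of_ends _ _ X X' Y); rewrite /X /X' /Y; half_cycle_cases.
Qed.

(** The small end 2t moves to position 6t + 2, and those in between shift by one. *)
Lemma half_cycle_8t5 t : 0 < t -> exists S h, half_cycle (8 * t + 5) S h.
Proof.
move=> t_bound.
pose X (j : nat) :=
  if j < 2 * t then j else if j < 6 * t + 2 then j.+1
  else if j == 6 * t + 2 then 2 * t else j.
pose X' (j : nat) :=
  if j.+1 < 2 * t then j.+1 else if j < 6 * t + 1 then j.+2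
  else if j == 6 * t + 1 then 2 * t else if j == 8 * t + 4 then 0 else j.+1.
pose Y (j : nat) :=
  if j == 8 * t + 4 then 12 * t + 8 else if j == 4 * t then 16 * t + 11
  else if j.+1 == 2 * t then 18 * t + 11 else 16 * t + 8 - j.
exists (32 * t + 20), (fun p => if odd p then Y p./2 else X p./2).
by apply: (@half_cycle_of_ends _ _ X X' Y); rewrite /X /X' /Y; half_cycle_cases.
Qed.

(** * Assembling all k *)

Lemma half_cycle_exists k : 1 < k -> exists S h, half_cycle k S h.
Proof.
move=> k_gt1; have [->|ne2] := eqVneq k 2.
  by eexists _, _; exact: half_cycle2.
have [->|ne5] := eqVneq k 5; first by eexists _, _; exact: half_cycle5.
have [->|ne9] := eqVneq k 9; first by eexists _, _; exact: half_cycle9.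
have [r0|r0] := eqVneq (k %% 4) 0.
  by have -> : k = 4 * (k %/ 4); [lia | apply: half_cycle_4t; lia].
have [r3|r3] := eqVneq (k %% 4) 3.
  by have -> : k = 4 * (k %/ 4) + 3; [lia | apply: half_cycle_4t3].
have [r2|r2] := eqVneq (k %% 4) 2.
  by have -> : k = 4 * (k %/ 4) + 2; [lia | apply: half_cycle_4t2; lia].
have [r1|r1] := eqVneq (k %% 8) 1.
  by have -> : k = 8 * (k %/ 8) + 1; [lia | apply: half_cycle_8t1; lia].
by have -> : k = 8 * (k %/ 8) + 5; [lia | apply: half_cycle_8t5; lia].
Qed.

(* For k = 1 both edges of a 2-cycle have the same length, so no half cycle
   exists. *)
Lemma labelling1 : labelling 1 (nth 0 [:: 0; 3; 2; 4]).
Proof.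
by split; do ?[by do 4?[case=> //] | by do 4?[case=> //] => -[|[|[|[|]]]]].
Qed.

Lemma labelling_exists k : 0 < k -> exists f, labelling k f.
Proof.
rewrite leq_eqVlt => /predU1P[<-|k_gt1]; first by eexists; exact: labelling1.
have [S [h hc]] := half_cycle_exists k_gt1.
by exists (mirrored k S h); apply: labelling_mirrored => //; apply: ltnW.
Qed.

Unset Implicit Arguments.

Theorem theorem6p6 (k l : nat) (hk : (1 <= k)%N) (hl : (1 <= l)%N) :
  exists A : 'I_(4 * k) -> {set 'Z_(4 * k * l ^ 2 + 1)},
    is_CEDF (4 * k * l ^ 2 + 1) (4 * k) l 1 2 A.
Proof.
by have [f f_lab] := labelling_exists hk; apply: CEDF_of_labelling hk hl f_lab.
Qed.
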